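(* Let $(\Omega,\Sigma,\mu)$ be a non-atomic $\sigma$-finite complete measure space and let $p,q:\Omega\to[1,\infty)$ be two measurable functions satisfying $q(t)\le p(t)$ for $\mu$-a.e. $t\in\Omega$. Then $$M(L^{p(\cdot)},L^{q(\cdot)})=L^{r(\cdot)},$$ (equality as sets, with equivalent norms), where $r:\Omega\to[1,\infty]$ is given by $\frac{1}{p(t)}+\frac{1}{r(t)}=\frac{1}{q(t)}$ for $\mu$-a.e. $t\in\Omega$.
   Context: $L^0$ is the space of (a.e. equivalence classes of) real-valued measurable a.e. finite functions on $\Omega$. For a measurable exponent $p$ the variable exponent (Nakano) space is $L^{p(\cdot)}=\{x\in L^0: I(\lambda x)<\infty\text{ for some }\lambda>0\}$, where $I(x)=\int_\Omega\varphi(t,|x(t)|)\,d\mu(t)$ and $\varphi(t,u)=u^{p(t)}$, with the norm $\|x\|=\inf\{\lambda>0:I(x/\lambda)\le 1\}$. Where the exponent equals $\infty$ (which happens for $r$ where $p(t)=q(t)$, with $1/\infty=0$), $u^{\infty}$ is understood as $0$ for $0\le u\le 1$ and $\infty$ for $u>1$. $M(X,Y)=\{y\in L^0: xy\in Y\text{ for all }x\in X\}$ with norm $\|y\|_M=\sup_{\|x\|_X\le 1}\|xy\|_Y$ is the space of pointwise multipliers from $X$ to $Y$. *)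

(* Defs.v *)
From HB Require Import structures.
From mathcomp Require Import all_boot all_order all_algebra.
From mathcomp Require Import all_classical all_reals all_analysis.
From mathcomp Require Import measurable_realfun.
Set Implicit Arguments.
Unset Strict Implicit.
Unset Printing Implicit Defensive.
Import Order.TTheory GRing.Theory Num.Theory.
Import numFieldNormedType.Exports.

Local Open Scope classical_set_scope.
Local Open Scope ring_scope.

Section nonatomic.
Context d (T : measurableType d) (R : realType).
Variable mu : {measure set T -> \bar R}.
Local Open Scope ereal_scope.

Definition is_atom (A : set T) : Prop :=
  [/\ measurable A, 0 < mu A &
    forall B, measurable B -> B `<=` A -> mu B = 0 \/ mu (A `\` B) = 0].

Definition nonatomic : Prop := forall A, ~ is_atom A.

End nonatomic.

Section L0.
Context d (T : measurableType d) (R : realType).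
Variable mu : {measure set T -> \bar R}.

(* Classes, modulo mu-a.e. equality, of everywhere finite measurable functions;
   an a.e. finite measurable function always has such a representative. *)
Definition L0 : Type := {mfun_ mu, T >-> R}.

Definition repL0 (x : L0) : {mfun T >-> R} := repr x.

Definition mulL0 (x y : L0) : L0 :=
  \pi_L0%qT (repL0 x * repL0 y : {mfun T >-> R}).

Lemma mulL0E (x y : L0) :
  {ae mu, forall t, repL0 (mulL0 x y) t = repL0 x t * repL0 y t}.
Proof.
have /eqmodP/asboolP : (repL0 (mulL0 x y) = repL0 x * repL0 y %[mod L0])%qT.
  exact: reprK.
by apply: filterS => t; exact.
Qed.

End L0.

Section variable_exponent.
Context d (T : measurableType d) (R : realType).
Variable mu : {measure set T -> \bar R}.
Local Open Scope ereal_scope.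

(* u ^ e for 0 <= u and 1 <= e <= +oo; the value at e = -oo is junk. *)
Definition expo_pow (e : \bar R) (u : R) : \bar R :=
  match e with
  | s%:E => (u `^ s)%:E
  | +oo => if (u <= 1)%R then 0 else +oo
  | -oo => 0
  end.

Definition modular (p : T -> \bar R) (f : T -> R) : \bar R :=
  \int[mu]_t expo_pow (p t) `|f t|%R.

Definition Lexp (p : T -> \bar R) : set (L0 mu) :=
  [set x | exists2 lambda : R, (0 < lambda)%R &
    modular p (fun t => lambda * repL0 x t)%R < +oo].

(* Luxemburg norm; it is +oo outside of Lexp p, where the set is empty. *)
Definition Lexp_norm (p : T -> \bar R) (x : L0 mu) : \bar R :=
  ereal_inf [set lambda%:E | lambda in
    [set lambda : R | (0 < lambda)%R /\
      modular p (fun t => repL0 x t / lambda)%R <= 1]].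

Definition multiplier (X Y : set (L0 mu)) : set (L0 mu) :=
  [set y | forall x, X x -> Y (mulL0 x y)].

Definition multiplier_norm (X : set (L0 mu)) (nX nY : L0 mu -> \bar R)
    (y : L0 mu) : \bar R :=
  ereal_sup [set nY (mulL0 x y) | x in [set x | X x /\ nX x <= 1]].

(* The constants are finite, so two equivalent norms are also finite at the
   same points of X. *)
Definition equivalent_norms_on (X : set (L0 mu)) (n1 n2 : L0 mu -> \bar R) :
    Prop :=
  exists c C : R, [/\ (0 < c)%R, (0 < C)%R &
    forall y, X y -> c%:E * n1 y <= n2 y /\ n2 y <= C%:E * n1 y].

End variable_exponent.

Arguments Lexp {d T R} mu p _.
Arguments Lexp_norm {d T R} mu p x.

(* Main.v *)
(** Young's inequality [(u v)^q <= u^p + v^r] gives Hölder's inequality for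
    modulars, hence the inclusion of L^r in the multipliers and the bound of the
    multiplier norm.

    Conversely, let [I_r(f/2) > 1].  As [mu] is sigma-finite, there is a finite
    [0 <= w <= |f/2|^r] with [1 < \int w < oo]; dividing by the integral gives
    [v <= w] with [\int v = 1].  Then [x = v^(1/p)] has [I_p(x) = 1], whereas
    [v <= (x |f/2|)^q] pointwise, so [I_q(x f) >= 2 I_q(x f/2) >= 2].  Hence [f]
    is not a contractive multiplier.  Where [r = oo] the same [x] works because
    [v > 0] forces [|f/2| > 1] there.

    Boundedness of a pointwise multiplier [f] is a gliding hump argument: if
    [I_p(x_n) <= 1] and [I_q(x_n f/4^n) > 1] for all [n], then
    [z = (\sum_n 2^-(n+1) |x_n|^p)^(1/p)] lies in L^p, and
    [|x_n| <= 2^(n+1) z] shows that [z f] does not lie in L^q. *)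
Require Import Defs.
From HB Require Import structures.
From mathcomp Require Import all_boot all_order all_algebra.
From mathcomp Require Import all_classical all_reals all_analysis.
From mathcomp Require Import measurable_realfun.
From mathcomp Require Import ring lra.
Import Order.TTheory GRing.Theory Num.Theory.
Import numFieldNormedType.Exports.

Local Open Scope classical_set_scope.
Local Open Scope ring_scope.

(** * Pointwise inequalities for powers with an extended real exponent *)

Section expo_pow_theory.
Set Implicit Arguments.
Unset Strict Implicit.
Context {R : realType}.
Implicit Types (e : \bar R) (p q u v w x : R).

Lemma expo_pow_ge0 e u : (0 <= expo_pow e u)%E.
Proof. by case: e => [s||] //=; [rewrite lee_fin powR_ge0|case: ifP]. Qed.

Lemma le_expo_pow e u v : (1 <= e)%E -> 0 <= u -> u <= v ->
  (expo_pow e u <= expo_pow e v)%E.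
Proof.
case: e => [s||] //= s1 u0 uv.
  rewrite lee_fin in s1 *; apply: ge0_ler_powR; rewrite ?nnegrE//; lra.
by case: ifPn => u1; case: ifPn => v1 //; rewrite (le_trans uv v1) in u1.
Qed.

(** For a finite exponent [s >= 1], [c ^ s <= c]. At [+oo] both sides vanish if [u <= 1], and
    otherwise the right side is [+oo] because [c > 0]. *)
Lemma expo_powZ_le e c u : (1 <= e)%E -> 0 < c -> c <= 1 -> 0 <= u ->
  (expo_pow e (c * u) <= c%:E * expo_pow e u)%E.
Proof.
move=> e1 c0 c1 u0; case: e e1 => [s||] //= s1.
  rewrite lee_fin in s1; rewrite -EFinM lee_fin powRM ?(ltW c0)//.
  apply: ler_wpM2r; first exact: powR_ge0.
  by rewrite -[leRHS]powRr1 ?(ltW c0)// ger_powR// c0.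
case: (leP u 1) => u1; last by rewrite gt0_muley ?lte_fin// leey.
by rewrite mule0 (le_trans _ u1)// -[leRHS]mul1r ler_wpM2r.
Qed.

(** With [1/oo = 0] the infinite case is exactly [p = q]. In the finite case, multiplying by [q]
    shows that [p / q] and [s / q] are conjugate exponents. *)
Lemma conjugate_exponentP p q e : 1 <= p -> 1 <= q -> (1 <= e)%E ->
  (p%:E^-1 + e^-1 = q%:E^-1)%E ->
  (e = +oo%E /\ p = q) \/
  exists2 s, e = s%:E & 1 <= s /\ q / p + q / s = 1.
Proof.
move=> p1 q1 e1; have p0 : p != 0 by rewrite gt_eqF// (lt_le_trans ltr01).
have q0 : q != 0 by rewrite gt_eqF// (lt_le_trans ltr01).
rewrite !inver (negbTE p0) (negbTE q0); case: e e1 => [s||] //= s1.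
  rewrite lee_fin in s1.
  have s0 : s != 0 by rewrite gt_eqF// (lt_le_trans ltr01).
  rewrite inver (negbTE s0) => -[H]; right; exists s => //; split => //.
  by rewrite -mulrDr H divff.
by rewrite invey adde0 => -[/invr_inj->]; left.
Qed.

(** Young's inequality is applied to [u ^ q] and [v ^ q] with exponents [p / q] and [s / q]; its
    coefficients [q / p] and [q / s] are at most 1 and are dropped. At [e = +oo] either [v <= 1] or
    the right side is infinite. *)
Lemma expo_pow_young p q e u v : 1 <= p -> 1 <= q -> (1 <= e)%E ->
  (p%:E^-1 + e^-1 = q%:E^-1)%E -> 0 <= u -> 0 <= v ->
  (((u * v) `^ q)%:E <= (u `^ p)%:E + expo_pow e v)%E.
Proof.
move=> p1 q1 e1 H u0 v0.
have p0 : 0 < p by rewrite (lt_le_trans ltr01).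
have q0 : 0 < q by rewrite (lt_le_trans ltr01).
case: (conjugate_exponentP p1 q1 e1 H) => [[-> <-]|[s -> [s1 qps]]] /=.
  case: (leP v 1) => v1; last by rewrite addey// leey.
  rewrite adde0 lee_fin.
  apply: ge0_ler_powR; rewrite ?nnegrE ?mulr_ge0 ?(ltW p0)//.
  by rewrite -[leRHS]mulr1 ler_wpM2l.
have s0 : 0 < s by rewrite (lt_le_trans ltr01).
have qp0 : 0 < q / p by rewrite divr_gt0.
have qs0 : 0 < q / s by rewrite divr_gt0.
rewrite -EFinD lee_fin powRM//.
apply: le_trans (@conjugate_powR R _ _ (p / q) (s / q) _ _ _ _ _) _;
  rewrite ?powR_ge0 ?divr_gt0 ?invf_div//.
rewrite -!powRrM !(mulrC q) !divfK ?gt_eqF//.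
by rewrite lerD// ler_piMr ?powR_ge0//; lra.
Qed.

(** Extremal case of Young's inequality: [w = w ^ (q/p) * w ^ (q/s)], and [w <= v ^ s] bounds the
    second factor by [v ^ q]. At [e = +oo], either [w = 0] or [v > 1], and [p = q]. *)
Lemma expo_pow_young_eq p q e v w : 1 <= p -> 1 <= q -> (1 <= e)%E ->
  (p%:E^-1 + e^-1 = q%:E^-1)%E -> 0 <= v -> 0 <= w ->
  (w%:E <= expo_pow e v)%E -> w <= (w `^ p^-1 * v) `^ q.
Proof.
move=> p1 q1 e1 H v0 w0.
have p0 : 0 < p by rewrite (lt_le_trans ltr01).
have q0 : 0 < q by rewrite (lt_le_trans ltr01).
case: (conjugate_exponentP p1 q1 e1 H) => [[-> <-]|[s -> [s1 qps]]] /=.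
  case: (leP v 1) => v1.
    by rewrite lee_fin => w0'; rewrite (le_trans w0')// powR_ge0.
  move=> _; rewrite -{1}[w](@powRr1 R)// -(mulVf (lt0r_neq0 p0)) powRrM.
  apply: ge0_ler_powR; rewrite ?nnegrE ?mulr_ge0 ?powR_ge0 ?(ltW p0)//.
  by rewrite ler_peMr ?powR_ge0// ltW.
have s0 : 0 < s by rewrite (lt_le_trans ltr01).
rewrite lee_fin => wvs.
have [->|wn0] := eqVneq w 0; first by rewrite powR_ge0.
rewrite powRM ?powR_ge0// -powRrM.
have -> : v `^ q = (v `^ s) `^ (q / s).
  by rewrite -powRrM mulrC divfK// gt_eqF.
apply: (@le_trans _ _ (w `^ (q / p) * w `^ (q / s))).
  rewrite -powRD; last by rewrite wn0 implybT.
  by rewrite qps powRr1.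
rewrite (mulrC q) ler_wpM2l ?powR_ge0// ge0_ler_powR ?nnegrE ?powR_ge0//.
by rewrite ltW// divr_gt0.
Qed.

End expo_pow_theory.

(** * Measurability, and truncation on sigma-finite spaces *)

Section measurability.
Set Implicit Arguments.
Unset Strict Implicit.
Context d (T : measurableType d) (R : realType).

Lemma measurable_fun_powR (u e : T -> R) : measurable_fun [set: T] u ->
  measurable_fun [set: T] e -> measurable_fun [set: T] (fun t => u t `^ e t).
Proof.
move=> mu me; rewrite /powR; apply: measurable_fun_ifT.
- exact: measurable_fun_eqr.
- have -> : (fun t => (e t == 0)%:R) =
      (fun t => if e t == 0 then 1 else 0) :> (T -> R).
    by apply/funext => t; case: (e t == 0).
  by apply: measurable_fun_ifT => //; exact: measurable_fun_eqr.
- apply: measurableT_comp => //; apply: measurable_funM => //.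
  exact: measurableT_comp.
Qed.

Lemma measurable_fun_inv (f : T -> R) : (forall t, 0 <= f t) ->
  measurable_fun [set: T] f -> measurable_fun [set: T] (fun t => (f t)^-1).
Proof.
move=> f0 mf; rewrite (_ : (fun t => _) = (fun t => f t `^ (-1))).
  exact: measurable_fun_powR.
by apply/funext => t; rewrite powR_inv1.
Qed.

Lemma measurable_expo_pow (e : T -> \bar R) (u : T -> R) :
  measurable_fun [set: T] e -> measurable_fun [set: T] u ->
  measurable_fun [set: T] (fun t => expo_pow (e t) `|u t|).
Proof.
move=> me mu.
have mau : measurable_fun [set: T] (fun t => `|u t|).
  exact: measurableT_comp.
have -> : (fun t => expo_pow (e t) `|u t|) = (fun t =>
    if e t == +oo%E then (if (`|u t| <= 1)%R then 0 else +oo)%E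
    else if e t == -oo%E then 0%E else (`|u t| `^ fine (e t))%:E).
  by apply/funext => t; case: (e t).
apply: measurable_fun_ifT; first exact: measurable_fun_eqe.
  by apply: measurable_fun_ifT => //; exact: measurable_fun_ler.
apply: measurable_fun_ifT; [exact: measurable_fun_eqe|by []|].
apply/measurable_EFinP; apply: measurable_fun_powR => //.
exact: measurableT_comp.
Qed.

(** Cut [h], which may be infinite, at height [n] on the n-th set of an exhaustion by sets of finite
    measure. By monotone convergence the integrals of these cuts cannot all stay below 1. *)
Lemma sigma_finite_truncation (mu : {measure set T -> \bar R})
    (h : T -> \bar R) :
  sigma_finite [set: T] mu ->
  measurable_fun [set: T] h -> (forall t, (0 <= h t)%E) ->
  (1 < \int[mu]_t h t)%E ->
  exists2 w : T -> R, measurable_fun [set: T] w &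
    [/\ forall t, 0 <= w t, forall t, ((w t)%:E <= h t)%E &
      (1 < \int[mu]_t (w t)%:E < +oo)%E].
Proof.
move=> /sigma_finiteP[F [FT ndF /all_and2[mF Ffin]]] mh h0 h1.
pose b n t : R := n%:R * \1_(F n) t.
have b0 n t : 0 <= b n t by rewrite mulr_ge0// indicE ler0n.
have mb n : measurable_fun [set: T] (b n).
  by apply: measurable_funM => //; exact: measurable_indic.
have ndb t : {homo b^~ t : m n / (m <= n)%N >-> m <= n}.
  move=> m n mn; rewrite /b ler_pM ?indicE ?ler0n ?ler_nat//.
  case: (boolP (t \in F m)) => //=; rewrite inE => tm.
  rewrite mem_set//; have /subsetPset := ndF _ _ mn; exact.
pose g n t := mine (h t) (b n t)%:E.
have g0 n t : (0 <= g n t)%E by rewrite le_min h0 lee_fin b0.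
have gfin n t : g n t \is a fin_num.
  rewrite ge0_fin_numE// (@le_lt_trans _ _ (b n t)%:E) ?ltry//.
  by rewrite ge_min lexx orbT.
have mg n : measurable_fun [set: T] (g n).
  by apply: measurable_mine => //; exact/measurable_EFinP.
have ndg t : {homo g^~ t : m n / (m <= n)%N >-> (m <= n)%E}.
  by move=> m n mn; rewrite le_min2 ?lee_fin ?ndb.
(* Once [t] lies in [F N], the cut [g n t] is the minimum of [h t] and [n] for all [n >= N], so the
   limit reaches [h t] even if it is [+oo]. *)
have hg t : (h t <= limn (g^~ t))%E.
  rewrite (cvg_lim _ (ereal_nondecreasing_cvgn (ndg t)))//.
  have [N _ tN] : (\bigcup_i F i) t by rewrite -FT.
  have gN n : (N <= n)%N -> g n t = mine (h t) n%:R%:E.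
    move=> Nn; rewrite /g /b indicE mem_set ?mulr1//.
    by have /subsetPset := ndF _ _ Nn; exact.
  case: (h t) (h0 t) gN => [a||] // a0 gN.
    pose n := maxn N (Num.truncn a).+1.
    apply: le_ereal_sup_tmp; exists (g n t); first by exists n.
    rewrite gN ?leq_maxl// le_min lexx lee_fin/=.
    have /andP[_ /ltW/le_trans] := truncn_itv a0; apply.
    by rewrite ler_nat leq_maxr.
  rewrite leye_eq; apply/eqP/eq_infty => a.
  pose n := maxn N (Num.truncn `|a|).+1.
  apply: le_ereal_sup_tmp; exists (g n t); first by exists n.
  rewrite gN ?leq_maxl// le_min leey lee_fin/= (le_trans (ler_norm _))//.
  have /andP[_ /ltW/le_trans] := truncn_itv (normr_ge0 a); apply.
  by rewrite ler_nat leq_maxr.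
have [n gn] : exists n, (1 < \int[mu]_t g n t)%E.
  apply: contrapT => /forallNP Hn; move: h1; apply/negP; rewrite -leNgt.
  apply: (@le_trans _ _ (\int[mu]_t limn (g^~ t))%E).
    apply: ge0_le_integral => //.
    by apply: emeasurable_fun_cvg => // t _; apply: ereal_nondecreasing_is_cvgn.
  rewrite monotone_convergence//; apply: lime_le.
    apply: ereal_nondecreasing_is_cvgn => m k mk.
    by apply: ge0_le_integral => // t _; exact: ndg.
  by apply: nearW => k; rewrite leNgt; apply/negP; exact: Hn.
exists (fun t => fine (g n t)); first exact: measurableT_comp.
split => [t|t|]; [by rewrite fine_ge0|by rewrite fineK// ge_min lexx|].
under eq_integral do rewrite fineK//.
(* Finiteness: [g n] lies below [b n], whose integral is [n] times the finite measure of [F n]. *)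
rewrite gn/= (@le_lt_trans _ _ (\int[mu]_t (b n t)%:E)%E)//.
  apply: ge0_le_integral => //; first exact/measurable_EFinP.
  by move=> t _; rewrite ge_min lexx orbT.
under eq_integral do rewrite EFinM.
rewrite ge0_integralZl//; first last.
  by apply/measurable_EFinP; exact: measurable_indic.
rewrite integral_indic// setIT.
by apply: lte_mul_pinfty; [rewrite lee_fin| |exact: Ffin].
Qed.

(** Measurability of [r] is derived: [r] agrees almost everywhere with the explicit measurable
    function [r'], and completeness of [mu] transfers the property. *)
Lemma measurable_conjugate_exponent (mu : {measure set T -> \bar R})
    (p q : T -> R) (r : T -> \bar R) :
  measure_is_complete mu ->
  measurable_fun [set: T] p -> measurable_fun [set: T] q ->
  (forall t, 1 <= p t) -> (forall t, 1 <= q t) -> (forall t, (1 <= r t)%E) ->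
  {ae mu, forall t, (((p t)%:E)^-1 + (r t)^-1 = ((q t)%:E)^-1)%E} ->
  measurable_fun [set: T] r.
Proof.
move=> mu_complete mp mq p1 q1 r1 pqr.
pose r' t := (if p t == q t then +oo
  else (((q t)^-1 - (p t)^-1) `^ (-1))%:E)%E.
apply: (@ae_measurable_fun _ _ _ _ mu_complete _ r').
  apply: filterS pqr => t /(conjugate_exponentP (p1 t) (q1 t) (r1 t)) pqrt _.
  rewrite /r'; case: pqrt => [[-> ->]|[s rs [s1 qps]]]; first by rewrite eqxx.
  have q0 : 0 < q t by rewrite (lt_le_trans ltr01).
  have s0 : 0 < s by rewrite (lt_le_trans ltr01).
  have sE : s^-1 = (q t)^-1 - (p t)^-1.
    apply: (mulfI (lt0r_neq0 q0)); rewrite mulrBr divff ?lt0r_neq0//.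
    by rewrite -qps addrC addKr.
  rewrite ifF; first by rewrite -sE powR_inv1 ?invrK ?rs// invr_ge0 ltW.
  apply/eqP => pq; move: sE; rewrite pq subrr => /eqP.
  by rewrite invr_eq0 gt_eqF.
apply: measurable_fun_ifT; [exact: measurable_fun_eqr|by []|].
apply/measurable_EFinP/measurable_fun_powR => //.
by apply: measurable_funB; apply: measurable_fun_inv => // t;
   rewrite (le_trans ler01).
Qed.

End measurability.

(** * Inequalities between modulars, and boundedness of multipliers *)

Section modular_theory.
Set Implicit Arguments.
Unset Strict Implicit.
Context d (T : measurableType d) (R : realType).
Variable mu : {measure set T -> \bar R}.
Implicit Types (e : T -> \bar R) (f g : T -> R).

Lemma modular_ge0 e f : (0 <= modular mu e f)%E.
Proof. by apply: integral_ge0 => t _; exact: expo_pow_ge0. Qed.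

Lemma ae_le_modular e f g : (forall t, (1 <= e t)%E) ->
  measurable_fun [set: T] e ->
  measurable_fun [set: T] f -> measurable_fun [set: T] g ->
  {ae mu, forall t, `|f t| <= `|g t|} ->
  (modular mu e f <= modular mu e g)%E.
Proof.
move=> e1 me mf mg fg; apply: ae_ge0_le_integral => //.
- by move=> t _; exact: expo_pow_ge0.
- exact: measurable_expo_pow.
- by move=> t _; exact: expo_pow_ge0.
- exact: measurable_expo_pow.
- by apply: filterS fg => t fg _; exact: le_expo_pow.
Qed.

(** This is convexity of the modular on the segment from 0 to [f]; it turns a small factor on a
    function into a small factor on its modular. *)
Lemma modularZ_le e f c : (forall t, (1 <= e t)%E) ->
  measurable_fun [set: T] e -> measurable_fun [set: T] f ->
  0 < c -> c <= 1 ->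
  (modular mu e (fun t => c * f t)%R <= c%:E * modular mu e f)%E.
Proof.
move=> e1 me mf c0 c1; rewrite /modular -ge0_integralZl//; first last.
- by rewrite lee_fin ltW.
- by move=> t _; exact: expo_pow_ge0.
- exact: measurable_expo_pow.
apply: ge0_le_integral => //.
- by move=> t _; exact: expo_pow_ge0.
- by apply: measurable_expo_pow => //; exact: measurable_funM.
- by apply: emeasurable_funM => //; exact: measurable_expo_pow.
- by move=> t _; rewrite normrM (gtr0_norm c0) expo_powZ_le.
Qed.

Section conjugate.
Variables (p q : T -> R) (r : T -> \bar R).
Hypothesis mp : measurable_fun [set: T] p.
Hypothesis mq : measurable_fun [set: T] q.
Hypothesis mr : measurable_fun [set: T] r.
Hypothesis p1 : forall t, 1 <= p t.
Hypothesis q1 : forall t, 1 <= q t.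
Hypothesis r1 : forall t, (1 <= r t)%E.
Hypothesis pqr : {ae mu, forall t,
  (((p t)%:E)^-1 + (r t)^-1 = ((q t)%:E)^-1)%E}.

Lemma modular_hoelder f g :
  measurable_fun [set: T] f -> measurable_fun [set: T] g ->
  (modular mu (EFin \o q) (fun t => f t * g t)%R <=
   modular mu (EFin \o p) f + modular mu r g)%E.
Proof.
move=> mf mg; rewrite /modular -ge0_integralD//; first last.
- exact: measurable_expo_pow.
- by move=> t _; exact: expo_pow_ge0.
- by apply: measurable_expo_pow => //; exact/measurable_EFinP.
- by move=> t _; exact: expo_pow_ge0.
apply: ae_ge0_le_integral => //.
- by move=> t _; exact: expo_pow_ge0.
- apply: measurable_expo_pow; first exact/measurable_EFinP.
  exact: measurable_funM.
- by move=> t _; rewrite adde_ge0// expo_pow_ge0.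
- apply: emeasurable_funD; apply: measurable_expo_pow => //.
  exact/measurable_EFinP.
- apply: filterS pqr => t pqrt _ /=; rewrite normrM.
  exact: expo_pow_young.
Qed.

Lemma modular_hoelder_converse f : sigma_finite [set: T] mu ->
  measurable_fun [set: T] f ->
  (forall x : T -> R, measurable_fun [set: T] x ->
    (modular mu (EFin \o p) x <= 1)%E ->
    (modular mu (EFin \o q) (fun t => x t * f t)%R <= 1)%E) ->
  (modular mu r (fun t => f t / 2)%R <= 1)%E.
Proof.
move=> sfin mf Hf; rewrite leNgt; apply/negP => h1.
have mf2 : measurable_fun [set: T] (fun t => f t / 2).
  exact: measurable_funM.
have [w mw [w0 wh /andP[w1 woo]]] := sigma_finite_truncation sfin
  (measurable_expo_pow mr mf2) (fun t => expo_pow_ge0 _ _) h1.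
have Iw : (\int[mu]_t (w t)%:E)%E = (fine (\int[mu]_t (w t)%:E)%E)%:E.
  by rewrite fineK// ge0_fin_numE// integral_ge0// => t _; rewrite lee_fin.
set I := fine _ in Iw.
have I1 : 1 < I by rewrite -lte_fin -Iw.
have I0 : 0 < I by rewrite (lt_trans ltr01).
(* Since [I > 1], normalising keeps [v <= w], hence [v <= |f / 2| ^ r]. *)
pose v t := I^-1 * w t.
have mv : measurable_fun [set: T] v by exact: measurable_funM.
have v0 t : 0 <= v t by rewrite mulr_ge0// invr_ge0 ltW.
have Iv : (\int[mu]_t (v t)%:E = 1)%E.
  under eq_integral do rewrite EFinM.
  rewrite ge0_integralZl//.
  - by rewrite Iw -EFinM mulVf// gt_eqF.
  - exact/measurable_EFinP.
  - by move=> t _; rewrite lee_fin.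
  - by rewrite lee_fin invr_ge0 ltW.
pose x t := v t `^ (p t)^-1.
have mx : measurable_fun [set: T] x.
  apply: measurable_fun_powR => //.
  by apply: measurable_fun_inv => // t; rewrite (le_trans ler01).
have Ix : modular mu (EFin \o p) x = 1%E.
  rewrite -Iv; apply: eq_integral => t _ /=.
  rewrite ger0_norm ?powR_ge0// -powRrM mulVf ?powRr1//.
  by rewrite gt_eqF// (lt_le_trans ltr01).
have mxf : measurable_fun [set: T] (fun t => x t * f t).
  exact: measurable_funM.
have mEq : measurable_fun [set: T] (EFin \o q) by exact/measurable_EFinP.
have q1E t : (1 <= (EFin \o q) t)%E by rewrite lee_fin.
(* Halving makes the two bounds incompatible: [x * f / 2] has modular at most 1/2 by convexity, but
   at least the integral of [v], which is 1. *)
have : (modular mu (EFin \o q) (fun t => 2^-1 * (x t * f t))%R <= (2^-1)%:E)%E.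
  apply: le_trans (modularZ_le q1E mEq mxf _ _) _ => //; first lra.
  by rewrite -[leRHS]mule1 lee_pmul2l// Hf// Ix.
apply/negP; rewrite -ltNge (@lt_le_trans _ _ 1%E)//.
  by rewrite lte_fin; lra.
rewrite -Iv; apply: ae_ge0_le_integral => //.
- by move=> t _; rewrite lee_fin.
- exact/measurable_EFinP.
- by move=> t _; exact: expo_pow_ge0.
- by apply: measurable_expo_pow => //; exact: measurable_funM.
- apply: filterS pqr => t pqrt _ /=.
  rewrite lee_fin mulrCA normrM (ger0_norm (powR_ge0 _ _)) (mulrC 2^-1).
  apply: (expo_pow_young_eq (p1 t) (q1 t) (r1 t) pqrt) => //.
  apply: le_trans (wh t); rewrite lee_fin ler_piMl// invf_le1//; exact: ltW.
Qed.

End conjugate.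

(** In the hypothesis the scalar [l] may depend on [x]; the gliding hump produces one scalar [s] for
    the whole unit ball. *)
Lemma pointwise_multiplier_bounded (p q : T -> R) f :
  measurable_fun [set: T] p -> measurable_fun [set: T] q ->
  (forall t, 1 <= p t) -> (forall t, 1 <= q t) ->
  measurable_fun [set: T] f ->
  (forall x : T -> R, measurable_fun [set: T] x ->
    (modular mu (EFin \o p) x < +oo)%E ->
    exists2 l : R, 0 < l &
      (modular mu (EFin \o q) (fun t => l * (x t * f t))%R < +oo)%E) ->
  exists2 s : R, 0 < s & forall x : T -> R, measurable_fun [set: T] x ->
    (modular mu (EFin \o p) x <= 1)%E ->
    (modular mu (EFin \o q) (fun t => x t * (f t / s))%R <= 1)%E.
Proof.
move=> mp mq p1 q1 mf Hf.
have mEp : measurable_fun [set: T] (EFin \o p) by exact/measurable_EFinP.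
have mEq : measurable_fun [set: T] (EFin \o q) by exact/measurable_EFinP.
have q1E t : (1 <= (EFin \o q) t)%E by rewrite lee_fin.
apply: contrapT => /forall2NP Hs.
have {Hs} /choice[x Hx] : forall n, exists x : T -> R,
    [/\ measurable_fun [set: T] x,
    (modular mu (EFin \o p) x <= 1)%E &
    (1 < modular mu (EFin \o q) (fun t => x t * (f t / 4 ^+ n))%R)%E].
  move=> n.
  have [|/existsNP[x /not_implyP[mx /not_implyP[x1 /negP]]]] := Hs (4 ^+ n).
    by rewrite exprn_gt0.
  by rewrite -ltNge => xf; exists x.
(* The weights sum to 1, in the form that [epsilon_trick0] expects. *)
pose c n : R := 1 / (2 ^ n.+1)%:R.
have c0 n : 0 < c n by rewrite divr_gt0// ltr0n expn_gt0.
have c1 n : c n <= 1.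
  by rewrite ler_pdivrMr ?ltr0n ?expn_gt0// mul1r ler1n expn_gt0.
pose u n t := ((c n)%:E * expo_pow (p t)%:E `|x n t|)%E.
have u0 n t : (0 <= u n t)%E by rewrite mule_ge0 ?expo_pow_ge0// lee_fin ltW.
have mu_ n : measurable_fun [set: T] (u n).
  apply: emeasurable_funM => //; apply: measurable_expo_pow => //.
  by have [] := Hx n.
pose G t := (\sum_(n <oo) u n t)%E.
have G0 t : (0 <= G t)%E by exact: nneseries_ge0.
have mG : measurable_fun [set: T] G.
  by apply: ge0_emeasurable_sum.
have IG : (\int[mu]_t G t <= 1)%E.
  rewrite integral_nneseries//; apply: le_trans (epsilon_trick0 xpredT ler01).
  apply: lee_nneseries => // [n _|n _]; first by rewrite integral_ge0.
  have [mx x1 _] := Hx n.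
  rewrite ge0_integralZl//; first last.
  - by rewrite lee_fin ltW.
  - by move=> t _; exact: expo_pow_ge0.
  - exact: measurable_expo_pow.
  by rewrite -[leRHS]mule1 lee_pmul2l ?lte_fin.
have Gfin : {ae mu, forall t, G t \is a fin_num}.
  suff /(integrable_ae measurableT) : mu.-integrable [set: T] G.
    by apply: filterS => t; exact.
  apply/integrableP; split => //.
  by under eq_integral do rewrite gee0_abs//; rewrite (le_lt_trans IG)// ltry.
(* Where [G] is infinite, [fine] sends it to 0; this happens only on a null set. *)
pose z t := fine (G t) `^ (p t)^-1.
have mz : measurable_fun [set: T] z.
  apply: measurable_fun_powR; first exact: measurableT_comp.
  by apply: measurable_fun_inv => // t; rewrite (le_trans ler01).
have zp t : `|z t| `^ p t = fine (G t).
  rewrite ger0_norm ?powR_ge0// -powRrM mulVf ?powRr1 ?fine_ge0//.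
  by rewrite gt_eqF// (lt_le_trans ltr01).
have [|l l0 Hl] := Hf z mz.
  apply: (@le_lt_trans _ _ 1%E); last by rewrite ltry.
  apply: le_trans IG; apply: ge0_le_integral => //.
  - by move=> t _; exact: expo_pow_ge0.
  - exact: measurable_expo_pow.
  - move=> t _ /=; rewrite zp; have := G0 t.
    by case: (G t) => [g||] //= _; rewrite leey.
have mzf : measurable_fun [set: T] (fun t => l * (z t * f t)).
  by apply: measurable_funM => //; exact: measurable_funM.
pose M := fine (modular mu (EFin \o q) (fun t => l * (z t * f t))).
have ME : modular mu (EFin \o q) (fun t => l * (z t * f t)) = M%:E.
  by rewrite fineK// ge0_fin_numE// modular_ge0.
have M0 : 0 <= M by rewrite fine_ge0// modular_ge0.
(* The choice of [n] gives [k * (1 + M) < 1] for [k] below; [1 + M] in place of [M] also forces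
   [k <= 1], as [modularZ_le] demands. *)
have [n nM] : exists n, 2 / l * (1 + M) < 2 ^+ n.
  have B0 : 0 <= 2 / l * (1 + M) by rewrite mulr_ge0 ?divr_ge0 ?ltW//; lra.
  exists (Num.truncn (2 / l * (1 + M))).+1.
  have /andP[_ /lt_le_trans] := truncn_itv B0; apply.
  by rewrite -natrX ler_nat ltnW// ltn_expl.
have [mx _ xf] := Hx n.
(* [k * l = 2 ^ (n+1) / 4 ^ n], the factor left after [|x n| <= 2 ^ (n+1) * z] and the division by
   [4 ^ n]. *)
pose k := 2 / l / 2 ^+ n.
have k0 : 0 < k by rewrite !divr_gt0.
have kM : k * (1 + M) < 1 by rewrite /k mulrAC ltr_pdivrMr ?mul1r// exprn_gt0.
have k1 : k <= 1 by nra.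
have : (modular mu (EFin \o q) (fun t => x n t * (f t / 4 ^+ n))%R <=
        modular mu (EFin \o q) (fun t => k * (l * (z t * f t)))%R)%E.
  apply: ae_le_modular => //.
  - by apply: measurable_funM => //; exact: measurable_funM.
  - exact: measurable_funM.
  - apply: filterS Gfin => t Gt.
    (* As [c n <= 1 <= p t], the p-th power of the left side is at most [u n t], a single term of
       the series [G t]; then take p-th roots. *)
    have xz : c n * `|x n t| <= z t.
      have : (u n t <= G t)%E.
        apply: le_trans (nneseries_lim_ge n.+1 _) => //.
        by rewrite big_nat_recr//= leeDr// sume_ge0.
      rewrite /u -(fineK Gt) => uG.
      have p1E : (1 <= (p t)%:E)%E by rewrite lee_fin.
      have := le_trans (expo_powZ_le p1E (c0 n) (c1 n) (normr_ge0 _)) uG.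
      rewrite lee_fin => cx.
      have p0 : 0 < p t by rewrite (lt_le_trans ltr01).
      have -> : c n * `|x n t| = ((c n * `|x n t|) `^ p t) `^ (p t)^-1.
        by rewrite -powRrM divff ?gt_eqF// powRr1// mulr_ge0// ltW.
      apply: ge0_ler_powR => //; rewrite ?nnegrE ?powR_ge0 ?fine_ge0//.
      by rewrite invr_ge0 ltW.
    have z0 : 0 <= z t by rewrite powR_ge0.
    have -> : `|k * (l * (z t * f t))| = k * (l * (z t * `|f t|)).
      rewrite normrM (gtr0_norm k0) normrM (gtr0_norm l0).
      by rewrite normrM (ger0_norm z0).
    rewrite normrM [`|f t / _|]normrM normfV [`|4 ^+ n|]ger0_norm ?exprn_ge0//.
    have -> : k * (l * (z t * `|f t|)) = (z t / c n) * (`|f t| / 4 ^+ n).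
      rewrite /k /c natrX (_ : 4 = 2 * 2 :> R); last by rewrite -natrM.
      rewrite exprMn exprS; field.
      by rewrite ?expf_neq0 ?lt0r_neq0.
    by rewrite ler_wpM2r ?mulr_ge0 ?invr_ge0 ?exprn_ge0// ler_pdivlMr// mulrC.
(* This yields [1 < k * M], against [k * (1 + M) < 1]. *)
move=> /(lt_le_trans xf) /lt_le_trans /(_ (modularZ_le q1E mEq mzf k0 k1)).
rewrite ME -EFinM lte_fin; nra.
Qed.

End modular_theory.

(** * Representatives of classes and the Luxemburg norm *)

Section Lexp_theory.
Set Implicit Arguments.
Unset Strict Implicit.
Context d (T : measurableType d) (R : realType).
Variable mu : {measure set T -> \bar R}.
Implicit Types (x y : L0 mu) (e : T -> \bar R).

Lemma measurable_repL0 x : measurable_fun [set: T] (repL0 x).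
Proof. exact: measurable_funPT. Qed.

Lemma L0_representative (f : T -> R) : measurable_fun [set: T] f ->
  exists x, {ae mu, forall t, repL0 x t = f t}.
Proof.
move=> mf; pose g : {mfun T >-> R} := mfun_Sub (mem_set mf).
exists (\pi_(L0 mu)%qT g).
have /eqmodP/asboolP : (repL0 (\pi_(L0 mu) g) = g %[mod L0 mu])%qT.
  exact: reprK.
by apply: filterS => t; exact.
Qed.

Lemma Lexp_norm_ge0 e x : (0 <= Lexp_norm mu e x)%E.
Proof.
by apply: le_ereal_inf_tmp => _ [l [l0 _] <-]; rewrite lee_fin ltW.
Qed.

Lemma Lexp_norm_le e x s : 0 < s ->
  (modular mu e (fun t => repL0 x t / s)%R <= 1)%E ->
  (Lexp_norm mu e x <= s%:E)%E.
Proof. by move=> s0 xs; apply: ereal_inf_lbound; exists s. Qed.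

(** The strict inequality provides an admissible scalar below [s], so it need not be shown that the
    infimum is attained. *)
Lemma modular_Lexp_norm_lt e x s : (forall t, (1 <= e t)%E) ->
  measurable_fun [set: T] e -> (Lexp_norm mu e x < s%:E)%E ->
  (modular mu e (fun t => repL0 x t / s)%R <= 1)%E.
Proof.
move=> e1 me /ereal_inf_lt[_ [l [l0 xl] <-]]; rewrite lte_fin => ls.
apply: le_trans xl; have mx := @measurable_repL0 x.
apply: ae_le_modular => //; [exact: measurable_funM..|].
apply/aeW => t; rewrite !normrM ler_wpM2l// !normfV.
have s0 := lt_trans l0 ls.
by rewrite (gtr0_norm l0) (gtr0_norm s0) lef_pV2 ?posrE// ltW.
Qed.

End Lexp_theory.

Theorem corollary10 (d : measure_display) (T : measurableType d) (R : realType)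
    (mu : {measure set T -> \bar R})
    (mu_nonatomic : nonatomic mu)
    (mu_sigma_finite : sigma_finite [set: T] mu)
    (mu_complete : measure_is_complete mu)
    (p q : T -> R)
    (p_meas : measurable_fun [set: T] p) (q_meas : measurable_fun [set: T] q)
    (p_ge1 : forall t, 1 <= p t) (q_ge1 : forall t, 1 <= q t)
    (q_le_p : {ae mu, forall t, q t <= p t})
    (r : T -> \bar R)
    (r_ge1 : forall t, (1 <= r t)%E)
    (r_def : {ae mu, forall t,
      (((p t)%:E)^-1 + (r t)^-1 = ((q t)%:E)^-1)%E}) :
  let Lp := Lexp mu (EFin \o p) in
  let Lq := Lexp mu (EFin \o q) in
  let Lr := Lexp mu r in
  multiplier Lp Lq = Lr /\
  equivalent_norms_on Lr
    (Lexp_norm mu r)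
    (multiplier_norm Lp (Lexp_norm mu (EFin \o p)) (Lexp_norm mu (EFin \o q))).
Proof.
move=> Lp Lq Lr.
have r_meas := measurable_conjugate_exponent mu_complete p_meas q_meas
  p_ge1 q_ge1 r_ge1 r_def.
have p1 t : (1 <= (EFin \o p) t)%E by rewrite lee_fin.
have q1 t : (1 <= (EFin \o q) t)%E by rewrite lee_fin.
have mp : measurable_fun [set: T] (EFin \o p) by exact/measurable_EFinP.
have mq : measurable_fun [set: T] (EFin \o q) by exact/measurable_EFinP.
have mL := @measurable_repL0 _ _ _ mu.
(* Common core of the inclusion into [Lr] and of the lower norm bound; the factor 2 comes from
   [modular_hoelder_converse]. *)
have LrP (y : L0 mu) s : 0 < s ->
    (forall x : T -> R, measurable_fun [set: T] x ->
      (modular mu (EFin \o p) x <= 1)%E ->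
      (modular mu (EFin \o q) (fun t => x t * (repL0 y t / s))%R <= 1)%E) ->
    (modular mu r (fun t => repL0 y t / (s * 2))%R <= 1)%E.
  move=> s0 ys; under eq_fun do rewrite invfM mulrA.
  apply: (modular_hoelder_converse p_meas q_meas r_meas) => //.
  exact: measurable_funM.
split.
  apply/seteqP; split => y /=.
    move=> yM; have [x mx xoo|s s0 ys] := @pointwise_multiplier_bounded
        _ _ _ mu _ _ _ p_meas q_meas p_ge1 q_ge1 (mL y).
    - have [X Xx] := L0_representative mu mx.
      have [|l l0 lXy] := yM X.
        exists 1 => //; apply: le_lt_trans xoo; apply: ae_le_modular => //.
          exact: measurable_funM.
        by apply: filterS Xx => t ->; rewrite mul1r.
      exists l => //; apply: le_lt_trans lXy; apply: ae_le_modular => //.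
      + by apply: measurable_funM => //; exact: measurable_funM.
      + exact: measurable_funM.
      + by move: (mulL0E X y); apply: filterS2 Xx => t <- ->.
    - exists (s * 2)^-1; first by rewrite invr_gt0 mulr_gt0.
      under eq_fun do rewrite mulrC.
      by rewrite (le_lt_trans (LrP _ _ s0 ys))// ltry.
  move=> [b b0 yb] x [a a0 xa]; exists (a * b); first exact: mulr_gt0.
  apply: (@le_lt_trans _ _ (modular mu (EFin \o q)
      (fun t => (a * repL0 x t) * (b * repL0 y t))%R)).
    apply: ae_le_modular => //; [exact: measurable_funM| |].
      by apply: measurable_funM; exact: measurable_funM.
    by move: (mulL0E x y); apply: filterS => t ->; rewrite mulrACA.
  apply: (le_lt_trans
    (modular_hoelder p_meas q_meas r_meas _ _ _ r_def _ _)) => //.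
  - exact: measurable_funM.
  - exact: measurable_funM.
  - exact: lte_add_pinfty.
(* The lower bound holds since the [r]-norm is at most twice the multiplier norm. In the upper bound
   [4 = 2 * 2]: one factor passes from norm at most 1 to modular at most 1, the other absorbs the
   two terms of Hölder's inequality. *)
exists 4^-1, 4; split => // y _; split.
{ set n2 := multiplier_norm _ _ _ _.
  have n20 : (0 <= n2)%E.
    (* The zero class lies in the unit ball, so the supremum is not taken over the empty set, where
       it would be [-oo]. *)
    have [X X0] := L0_representative mu (@measurable_cst _ _ T R setT 0).
    have IX s : modular mu (EFin \o p) (fun t => s * repL0 X t)%R = 0%E.
      apply/eqP; rewrite eq_le modular_ge0 andbT.
      apply: (@le_trans _ _ (modular mu (EFin \o p) (cst 0))).
        apply: ae_le_modular => //; first exact: measurable_funM.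
        by apply: filterS X0 => t ->; rewrite mulr0.
      rewrite /modular integral0_eq// => t _ /=.
      by rewrite normr0 powR0// gt_eqF// (lt_le_trans ltr01).
    apply: le_trans (Lexp_norm_ge0 _ _) (ereal_sup_ubound _).
    exists X => //; split; first by exists 1; rewrite // IX ltry.
    apply: Lexp_norm_le => //; under eq_fun do rewrite mulrC.
    by rewrite IX.
  have n1n2 s : (n2 < s%:E)%E -> (Lexp_norm mu r y <= (s * 2)%:E)%E.
    move=> n2s; have s0 : 0 < s by rewrite -lte_fin (le_lt_trans n20).
    apply: Lexp_norm_le; first by rewrite mulr_gt0.
    apply: LrP => // x mx xp; have [X Xx] := L0_representative mu mx.
    apply: (@le_trans _ _ (modular mu (EFin \o q)
        (fun t => repL0 (mulL0 X y) t / s)%R)).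
      apply: ae_le_modular => //; [|exact: measurable_funM|].
        by apply: measurable_funM => //; exact: measurable_funM.
      by move: (mulL0E X y); apply: filterS2 Xx => t <- ->; rewrite mulrA.
    apply: modular_Lexp_norm_lt => //; apply: le_lt_trans n2s.
    apply: ereal_sup_ubound; exists X => //.
    have X1 : (modular mu (EFin \o p) (fun t => repL0 X t / 1)%R <= 1)%E.
      apply: le_trans xp; apply: ae_le_modular => //.
        exact: measurable_funM.
      by apply: filterS Xx => t ->; rewrite divr1.
    split; last exact: Lexp_norm_le.
    exists 1 => //; under eq_fun do rewrite mulrC -{1}[1]invr1.
    by rewrite (le_lt_trans X1)// ltry.
  case: n2 n20 n1n2 => [m||] //; last by move=> *; rewrite leey.
  rewrite lee_fin => m0 n1m.
  apply/lee_addgt0Pr => _/posnumP[e].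
  apply: (@le_trans _ _ ((4^-1)%:E * ((m + e%:num) * 2)%:E)%E).
    by rewrite lee_pmul2l ?lte_fin// n1m// lte_fin ltrDl.
  by rewrite -EFinM -EFinD lee_fin; have : 0 < e%:num by []; lra. }
suff n2l l : 0 < l -> (modular mu r (fun t => repL0 y t / l)%R <= 1)%E ->
    (multiplier_norm Lp (Lexp_norm mu (EFin \o p))
      (Lexp_norm mu (EFin \o q)) y <= (4 * l)%:E)%E.
  rewrite -lee_pdivrMl//; apply: le_ereal_inf_tmp => _ [l [l0 yl] <-].
  by rewrite lee_pdivrMl// -EFinM n2l.
move=> l0 yl; apply: ge_ereal_sup => _ [x [_ x1] <-].
apply: Lexp_norm_le; first by rewrite mulr_gt0.
(* Dividing by 2 makes the comparison with the norm strict. *)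
have x2 : (modular mu (EFin \o p) (fun t => repL0 x t / 2)%R <= 1)%E.
  apply: modular_Lexp_norm_lt => //.
  by rewrite (le_lt_trans x1)// lte_fin ltr1n.
have m2 : measurable_fun [set: T] (fun t => repL0 x t / 2).
  exact: measurable_funM.
have ml : measurable_fun [set: T] (fun t => repL0 y t / l).
  exact: measurable_funM.
(* The remaining factor 1/2 is pulled out by convexity and brings the Hölder bound [1 + 1] down to
   1. *)
apply: (@le_trans _ _ (modular mu (EFin \o q)
    (fun t => 2^-1 * ((repL0 x t / 2) * (repL0 y t / l)))%R)).
  apply: ae_le_modular => //; first exact: measurable_funM.
    by apply: measurable_funM => //; exact: measurable_funM.
  move: (mulL0E x y); apply: filterS => t ->.
  suff -> : repL0 x t * repL0 y t / (4 * l) =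
    2^-1 * (repL0 x t / 2 * (repL0 y t / l)) by [].
  by field; rewrite lt0r_neq0.
have m2l : measurable_fun [set: T] (fun t => (repL0 x t / 2) * (repL0 y t / l)).
  exact: measurable_funM.
apply: le_trans (@modularZ_le _ _ _ mu _ _ 2^-1 q1 mq m2l _ _) _; [lra|lra|].
rewrite lee_pdivrMl// mule1.
apply: (le_trans (modular_hoelder p_meas q_meas r_meas
  p_ge1 q_ge1 r_ge1 r_def m2 ml)).
by rewrite (_ : 2%:E = 1 + 1)%E// leeD.
Qed.
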